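(* Let $X_1,\dots,X_n$ be independent realizations of a random function $X$ on a functional manifold $\mathcal{M}\subset L^2(\mathcal{T})$ of intrinsic dimension $d$ with representation map $\psi$, let $\hat\psi(X_1),\dots,\hat\psi(X_n)\in\mathbb{R}^d$ be the estimates of $\psi(X_1),\dots,\psi(X_n)$, and let $v_n=\sup_{i=1,\dots,n}\|\hat\psi(X_i)-\psi(X_i)\|$. Assume: (B1) $\mathrm{E}v_n\to0$ as $n\to\infty$; (B2) each component of the $d$-vector $\psi(X)$ has a finite fourth moment, and the covariance matrix of $\psi(X)$ is positive definite. Let $\boldsymbol{\mu}=\mathrm{E}\{\psi(X)\}$ and $\hat{\boldsymbol{\mu}}=\frac1n\sum_{i=1}^n\hat\psi(X_i)$. Then $$\|\hat{\boldsymbol{\mu}}-\boldsymbol{\mu}\|=O_p\Bigl(v_n+\frac1{\sqrt n}\Bigr).$$ Moreover, if the $j$-th eigenvalue $\lambda_j^{\mathcal{M}}$ of $\mathrm{Cov}(\psi(X))$ is of multiplicity one, then $$\|\hat{\mathbf{e}}_j-\mathbf{e}_j\|=O_p\Bigl(v_n+\frac1{\sqrt n}\Bigr),\qquad |\hat\lambda_j^{\mathcal{M}}-\lambda_j^{\mathcal{M}}|=O_p\Bigl(v_n+\frac1{\sqrt n}\Bigr).$$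
   Context: $\mathcal{T}$ is a bounded domain (interval). A functional manifold of intrinsic dimension $d$ is a subset $\mathcal{M}\subset L^2(\mathcal{T})$ for which there is a bijection $\varphi:\mathbb{R}^d\to\mathcal{M}$ with $\varphi$ and $\varphi^{-1}$ continuous (Euclidean norm and $L^2$ norm); $\psi=\varphi^{-1}$ is called a representation map. $\mathrm{Cov}(\psi(X))=\sum_{j=1}^d\lambda_j^{\mathcal{M}}\mathbf{e}_j\mathbf{e}_j^T$ with $\lambda_1^{\mathcal{M}}\ge\dots\ge\lambda_d^{\mathcal{M}}$ and orthonormal $\mathbf{e}_j$. The estimates $\hat\lambda_j^{\mathcal{M}}$ (nonincreasing in $j$) and $\hat{\mathbf{e}}_j$ (orthonormal) are the eigenvalues and eigenvectors of the sample covariance matrix of $\hat\psi(X_1),\dots,\hat\psi(X_n)$: $$\sum_{j=1}^d\hat\lambda_j^{\mathcal{M}}\hat{\mathbf{e}}_j\hat{\mathbf{e}}_j^T=\frac1{n-1}\Bigl\{\sum_{i=1}^n\hat\psi(X_i)\hat\psi(X_i)^T-\frac1n\Bigl(\sum_{i=1}^n\hat\psi(X_i)\Bigr)\Bigl(\sum_{i=1}^n\hat\psi(X_i)\Bigr)^T\Bigr\}.$$ The vectors $\hat\psi(X_i)$ are data-based estimates (obtained by multidimensional scaling in $\mathbb{R}^d$, i.e. by minimizing $\sum_{i,j}\{\|\hat\psi(X_i)-\hat\psi(X_j)\|-\hat d_g(X_i,X_j)\}^2$, from shortest-path estimates $\hat d_g(X_i,X_j)$ of the pairwise geodesic distances on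 $\mathcal{M}$); their accuracy is taken as given and is quantified by the rate $v_n$. For random $a_n>0$, $Z_n=O_p(a_n)$ means that $Z_n/a_n$ is bounded in probability.
   Formalization: For the claim on the j-th eigenvector only, the sign of the estimated eigenvector is assumed chosen so that its inner product with e_j is nonnegative; eigenvectors are determined only up to sign, and without this the claim fails. *)

(* Defs.v *)
From HB Require Import structures.
From mathcomp Require Import all_boot all_order all_algebra.
From mathcomp Require Import all_classical all_reals all_analysis.
Set Implicit Arguments.
Unset Strict Implicit.
Unset Printing Implicit Defensive.
Import Order.TTheory GRing.Theory Num.Theory.
Import numFieldNormedType.Exports.
Local Open Scope classical_set_scope.
Local Open Scope ring_scope.

(* The library norm on matrices is the max norm, hence this definition. *)
Definition enorm (R : realType) (d : nat) (x : 'cV[R]_d) : R :=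
  Num.sqrt (\sum_(k < d) x k 0 ^+ 2).

Definition edist (R : realType) (d : nat) (x y : 'cV[R]_d) : R := enorm (x - y).

Definition dotcv (R : realType) (d : nat) (x y : 'cV[R]_d) : R :=
  (x^T *m y) 0 0.

(* L^2(I) consists of classes of measurable functions on R modulo equality
   almost everywhere for Lebesgue measure restricted to I, so the values
   outside I are irrelevant. *)
Definition L2 (R : realType) (I : interval R) : Type :=
  LspaceType2 (mrestr (@lebesgue_measure R) (measurable_itv I)).

Definition L2fun (R : realType) (I : interval R) (f : L2 I) : R -> R :=
  fun t => (f : LspaceType2 (mrestr (@lebesgue_measure R) (measurable_itv I))) t.

Definition L2dist (R : realType) (I : interval R) (f g : L2 I) : R :=
  fine (Lnorm (mrestr (@lebesgue_measure R) (measurable_itv I)) 2%:E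
          (fun t => (L2fun f t - L2fun g t)%:E)).

Definition L2open (R : realType) (I : interval R) (U : set (L2 I)) : Prop :=
  forall f, U f ->
    exists2 r : R, 0 < r & forall g, L2dist f g < r -> U g.

Definition L2borel (R : realType) (I : interval R) : set (set (L2 I)) :=
  <<s [set U : set (L2 I) | L2open U] >>.

Definition dist_continuous (R : realType) (A B : Type)
    (dA : A -> A -> R) (dB : B -> B -> R) (D : set A) (f : A -> B) : Prop :=
  forall x, D x -> forall eps : R, 0 < eps ->
    exists2 delta : R, 0 < delta &
      forall y, D y -> dA x y < delta -> dB (f x) (f y) < eps.

(* [M] is a functional manifold of intrinsic dimension [d] and [psi], whose
   values outside [M] are irrelevant, is a representation map for it. *)
Definition representation_map (R : realType) (I : interval R) (d : nat)
    (M : set (L2 I)) (psi : L2 I -> 'cV[R]_d) : Prop :=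
  exists phi : 'cV[R]_d -> L2 I,
    [/\ set_bij [set: 'cV[R]_d] M phi,
        cancel phi psi,
        dist_continuous (@edist R d) (@L2dist R I) [set: 'cV[R]_d] phi &
        dist_continuous (@L2dist R I) (@edist R d) M psi].

Definition random_function (R : realType) (I : interval R)
    (disp : measure_display) (Omega : measurableType disp)
    (X : Omega -> L2 I) : Prop :=
  forall A, L2borel A -> measurable (X @^-1` A).

Definition random_vector (R : realType) (d : nat)
    (disp : measure_display) (Omega : measurableType disp)
    (Y : Omega -> 'cV[R]_d) : Prop :=
  forall k : 'I_d, measurable_fun [set: Omega] (fun w => Y w k 0).

(* Since some of the sets [A i] may be the whole space, the product rule for
   all initial segments yields the one for all finite subfamilies. *)
Definition independent_functions (R : realType) (I : interval R)
    (disp : measure_display) (Omega : measurableType disp)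
    (P : probability Omega R) (X : nat -> Omega -> L2 I) : Prop :=
  forall (n : nat) (A : 'I_n -> set (L2 I)), (forall i, L2borel (A i)) ->
    P [set w | forall i : 'I_n, A i (X i w)] =
    (\prod_(i < n) fine (P (X i @^-1` A i)))%:E.

Definition same_distribution (R : realType) (I : interval R)
    (disp : measure_display) (Omega : measurableType disp)
    (P : probability Omega R) (X Y : Omega -> L2 I) : Prop :=
  forall A, L2borel A -> P (X @^-1` A) = P (Y @^-1` A).

Definition mean_vector (R : realType) (d : nat)
    (disp : measure_display) (Omega : measurableType disp)
    (P : probability Omega R) (Y : Omega -> 'cV[R]_d) : 'cV[R]_d :=
  \col_k fine ('E_P[fun w => (Y w k 0)%R])%E.

Definition cov_mx (R : realType) (d : nat)
    (disp : measure_display) (Omega : measurableType disp)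
    (P : probability Omega R) (Y : Omega -> 'cV[R]_d) : 'M[R]_d :=
  \matrix_(k, l) fine (covariance P (fun w => Y w k 0) (fun w => Y w l 0)).

Definition posdef_mx (R : realType) (d : nat) (S : 'M[R]_d) : Prop :=
  forall u : 'cV[R]_d, u != 0 -> 0 < (u^T *m S *m u) 0 0.

Definition sample_mean (R : realType) (d n : nat) (y : 'I_n -> 'cV[R]_d)
    : 'cV[R]_d :=
  n%:R^-1 *: \sum_(i < n) y i.

Definition sample_cov (R : realType) (d n : nat) (y : 'I_n -> 'cV[R]_d)
    : 'M[R]_d :=
  (n%:R - 1)^-1 *:
    (\sum_(i < n) y i *m (y i)^T
     - n%:R^-1 *: ((\sum_(i < n) y i) *m (\sum_(i < n) y i)^T)).

Definition spectral_decomposition (R : realType) (d : nat) (S : 'M[R]_d)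
    (lambda : 'I_d -> R) (e : 'I_d -> 'cV[R]_d) : Prop :=
  [/\ forall j k : 'I_d, (j <= k)%N -> lambda k <= lambda j,
      forall j k : 'I_d, dotcv (e j) (e k) = (j == k)%:R &
      S = \sum_(j < d) lambda j *: (e j *m (e j)^T)].

(* Z n = O_p(a n). Large values of the ratio are required to be covered by a
   measurable event of small probability, which for measurable ratios is the
   usual tightness condition and is also meaningful for other ones. *)
Definition bigOp (R : realType)
    (disp : measure_display) (Omega : measurableType disp)
    (P : probability Omega R) (Z a : nat -> Omega -> R) : Prop :=
  forall eps : R, 0 < eps -> exists K : R, \forall n \near \oo,
    exists B : set Omega,
      [/\ measurable B,
          [set w | K < `|Z n w / a n w|] `<=` B &
          (P B <= eps%:E)%E].

Definition max_error (R : realType) (I : interval R) (d : nat)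
    (Omega : Type) (psi : L2 I -> 'cV[R]_d) (X : nat -> Omega -> L2 I)
    (psihat : forall n : nat, 'I_n -> Omega -> 'cV[R]_d)
    (n : nat) (w : Omega) : R :=
  \big[Num.max/0]_(i < n) enorm (psihat n i w - psi (X i w)).

(* Main.v *)
(** Restricted to [M], the coordinates of [psi] and their pairwise products are
    continuous, so along the sample they form pairwise independent, identically
    distributed real variables, square integrable by the fourth moments;
    Chebyshev's inequality makes the first and second empirical moments of
    [psi (X_i)] tight at rate [1 / sqrt n], and Markov's inequality gives
    [v_n <= 1] with high probability. On that event, replacing [psi (X_i)] by
    its estimate moves those moments by [O(v_n)], so the sample mean and the
    entries of the sample covariance are within [O(v_n + 1 / sqrt n)] of [mu]
    and [Sigma]. Deterministic perturbation bounds for symmetric matrices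
    (Weyl for eigenvalues, the spectral gap for eigenvectors) carry this over
    to the spectral decomposition. *)
Require Import Defs.
From HB Require Import structures.
From mathcomp Require Import all_boot all_order all_algebra.
From mathcomp Require Import all_classical all_reals all_analysis.
From mathcomp Require Import measurable_realfun.
From mathcomp Require Import ring lra.
Set Implicit Arguments.
Unset Strict Implicit.
Unset Printing Implicit Defensive.
Import Order.TTheory GRing.Theory Num.Theory.
Import numFieldNormedType.Exports.
Local Open Scope classical_set_scope.
Local Open Scope ring_scope.

(** * Perturbation of symmetric matrices *)

Section EuclideanVectors.
Context {R : realType} {d : nat}.
Implicit Types (x y : 'cV[R]_d) (D S : 'M[R]_d) (e : 'I_d -> 'cV[R]_d).

Lemma dotcvE x y : dotcv x y = \sum_k x k 0 * y k 0.
Proof. by rewrite /dotcv mxE; apply: eq_bigr => k _; rewrite mxE. Qed.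

Lemma dotcvC x y : dotcv x y = dotcv y x.
Proof. by rewrite !dotcvE; apply: eq_bigr => k _; rewrite mulrC. Qed.

Lemma dotcv_ge0 x : 0 <= dotcv x x.
Proof. by rewrite dotcvE sumr_ge0// => k _; rewrite -expr2 sqr_ge0. Qed.

Lemma dotcv_gt0 x : x != 0 -> 0 < dotcv x x.
Proof.
move=> x0; rewrite lt_neqAle dotcv_ge0 andbT eq_sym; apply: contra x0.
rewrite dotcvE psumr_eq0; last by move=> k _; rewrite -expr2 sqr_ge0.
move=> /allP h; apply/eqP/matrixP => k l; rewrite ord1 mxE.
by have := h k (mem_index_enum _); rewrite mulf_eq0 orbb => /eqP.
Qed.

Lemma enorm_dot x : enorm x = Num.sqrt (dotcv x x).
Proof. by rewrite /enorm dotcvE; under eq_bigr do rewrite expr2. Qed.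

Lemma enorm_ge0 x : 0 <= enorm x.
Proof. exact: sqrtr_ge0. Qed.

Lemma sqr_enorm x : enorm x ^+ 2 = dotcv x x.
Proof. by rewrite enorm_dot sqr_sqrtr// dotcv_ge0. Qed.

Lemma coord_le_enorm x k : `|x k 0| <= enorm x.
Proof.
rewrite -(@ler_pXn2r _ 2%N)// ?nnegrE ?enorm_ge0// real_normK ?num_real//.
rewrite sqr_enorm dotcvE (bigD1 k)//= -expr2 lerDl.
by rewrite sumr_ge0// => i _; rewrite -expr2 sqr_ge0.
Qed.

Lemma enorm_le x (a : R) : 0 <= a -> dotcv x x <= a ^+ 2 -> enorm x <= a.
Proof.
by move=> a0 h; rewrite -(@ler_pXn2r _ 2%N)// ?nnegrE ?enorm_ge0// sqr_enorm.
Qed.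

Lemma dotcv_le_coord x (a : R) :
  (forall k, `|x k 0| <= a) -> dotcv x x <= d%:R * a ^+ 2.
Proof.
move=> h; rewrite dotcvE.
apply: (@le_trans _ _ (\sum_(k < d) a ^+ 2)); last first.
  by rewrite sumr_const card_ord mulr_natl.
apply: ler_sum => k _; rewrite -expr2 -(real_normK (num_real (x k 0))).
by rewrite ler_pXn2r// nnegrE ?(le_trans _ (h k)).
Qed.

Lemma enorm_le_coord x (a : R) : 0 <= a ->
  (forall k, `|x k 0| <= a) -> enorm x <= d%:R * a.
Proof.
move=> a0 h; apply: enorm_le; first by rewrite mulr_ge0.
apply: le_trans (dotcv_le_coord h) _.
rewrite exprMn ler_wpM2r ?sqr_ge0// -natrX ler_nat.
by case: (d) => // m; rewrite expnS leq_pmulr// expn_gt0.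
Qed.

Lemma mulmx_coord_le D (delta : R) x k : (forall i j, `|D i j| <= delta) ->
  `|(D *m x) k 0| <= d%:R * delta * enorm x.
Proof.
move=> h; rewrite mxE (le_trans (ler_norm_sum _ _ _))//.
apply: (@le_trans _ _ (\sum_(l < d) delta * enorm x)); last first.
  by rewrite sumr_const card_ord -mulrA mulr_natl.
by apply: ler_sum => l _; rewrite normrM ler_pM// coord_le_enorm.
Qed.

Lemma quad_form_le D (delta : R) x : (forall i j, `|D i j| <= delta) ->
  `|dotcv x (D *m x)| <= d%:R ^+ 2 * delta * dotcv x x.
Proof.
move=> h; rewrite dotcvE (le_trans (ler_norm_sum _ _ _))//.
apply: (@le_trans _ _ (\sum_(k < d) enorm x * (d%:R * delta * enorm x))).
  apply: ler_sum => k _; rewrite normrM ler_pM//; first exact: coord_le_enorm.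
  exact: mulmx_coord_le.
rewrite sumr_const card_ord -mulr_natl -sqr_enorm expr2.
by rewrite le_eqVlt; apply/orP; left; apply/eqP; ring.
Qed.

Lemma dotcvDl x x' y : dotcv (x + x') y = dotcv x y + dotcv x' y.
Proof. by rewrite /dotcv linearD/= mulmxDl mxE. Qed.

Lemma dotcvZl (a : R) x y : dotcv (a *: x) y = a * dotcv x y.
Proof. by rewrite /dotcv linearZ/= -scalemxAl mxE. Qed.

Lemma dotcvDr x y y' : dotcv x (y + y') = dotcv x y + dotcv x y'.
Proof. by rewrite !(dotcvC x) dotcvDl. Qed.

Lemma dotcvZr (a : R) x y : dotcv x (a *: y) = a * dotcv x y.
Proof. by rewrite !(dotcvC x) dotcvZl. Qed.

Lemma dotcv_sumr x (I : finType) (y : I -> 'cV[R]_d) :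
  dotcv x (\sum_i y i) = \sum_i dotcv x (y i).
Proof. by rewrite /dotcv mulmx_sumr summxE. Qed.

Lemma rank1_mul x y : (y *m y^T) *m x = dotcv y x *: y.
Proof.
by rewrite -mulmxA [y^T *m x]mx11_scalar mul_mx_scalar.
Qed.

(** * Expansions in an orthonormal basis *)

Section Orthonormal.
Variable e : 'I_d -> 'cV[R]_d.
Hypothesis e_orth : forall j k, dotcv (e j) (e k) = (j == k)%:R.

(** The square matrix [E] with columns [e j] satisfies [E^T E = 1], hence also [E E^T = 1];
    inserting the latter between [x^T] and [y] gives the expansion. *)
Lemma parseval x y : dotcv x y = \sum_j dotcv x (e j) * dotcv (e j) y.
Proof.
pose E : 'M[R]_d := \matrix_(k, j) e j k 0.
have EE : E^T *m E = 1%:M.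
  apply/matrixP => i j; rewrite !mxE -e_orth dotcvE.
  by apply: eq_bigr => k _; rewrite !mxE.
rewrite {1}/dotcv -[x^T]mulmx1 -(mulmx1C EE) mulmxA -mulmxA mxE.
apply: eq_bigr => j _; congr (_ * _).
  by rewrite mxE dotcvE; apply: eq_bigr => k _; rewrite !mxE.
by rewrite mxE dotcvE; apply: eq_bigr => k _; rewrite !mxE.
Qed.

Lemma dotcv_parseval x : dotcv x x = \sum_j dotcv x (e j) ^+ 2.
Proof.
rewrite (parseval x x); apply: eq_bigr => j _.
by rewrite (dotcvC (e j)) expr2.
Qed.

End Orthonormal.

(** * Quadratic form and eigenspaces of a spectral decomposition *)

Section Spectral.
Context {S : 'M[R]_d} {lambda : 'I_d -> R} {e : 'I_d -> 'cV[R]_d}.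
Hypothesis specS : spectral_decomposition S lambda e.

Lemma spectral_mul x : S *m x = \sum_j (lambda j * dotcv (e j) x) *: e j.
Proof.
have [_ _ ->] := specS; rewrite mulmx_suml; apply: eq_bigr => j _.
by rewrite -scalemxAl rank1_mul scalerA.
Qed.

Lemma spectral_dot x k : dotcv (S *m x) (e k) = lambda k * dotcv x (e k).
Proof.
have [_ oe _] := specS; rewrite dotcvC spectral_mul dotcv_sumr.
rewrite (bigD1 k)//= dotcvZr oe eqxx mulr1 big1 ?addr0 1?dotcvC//.
by move=> j jk; rewrite dotcvZr oe eq_sym (negPf jk) mulr0.
Qed.

Lemma spectral_eigen k : S *m e k = lambda k *: e k.
Proof.
have [_ oe _] := specS; rewrite spectral_mul (bigD1 k)//= oe eqxx mulr1.
by rewrite big1 ?addr0// => j jk; rewrite oe (negPf jk) mulr0 scale0r.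
Qed.

Lemma spectral_quad x :
  dotcv x (S *m x) = \sum_j lambda j * dotcv x (e j) ^+ 2.
Proof.
rewrite spectral_mul dotcv_sumr; apply: eq_bigr => j _.
by rewrite dotcvZr (dotcvC (e j)) -mulrA expr2.
Qed.

(** Only the weights [lambda i] with [i <= j] survive, and by monotonicity these are at least
    [lambda j]. This and its mirror image below are the two halves of the Courant-Fischer
    argument. *)
Lemma spectral_quad_ge (j : 'I_d) x : (forall i : 'I_d, (j < i)%N -> dotcv x (e i) = 0) ->
  lambda j * dotcv x x <= dotcv x (S *m x).
Proof.
move=> h; have [ld oe _] := specS.
rewrite (dotcv_parseval oe) spectral_quad mulr_sumr ler_sum// => i _.
have [ij|ji] := leqP i j; first by rewrite ler_wpM2r ?sqr_ge0 ?ld.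
by rewrite h// expr0n /= !mulr0.
Qed.

Lemma spectral_quad_le (j : 'I_d) x : (forall i : 'I_d, (i < j)%N -> dotcv x (e i) = 0) ->
  dotcv x (S *m x) <= lambda j * dotcv x x.
Proof.
move=> h; have [ld oe _] := specS.
rewrite (dotcv_parseval oe) spectral_quad mulr_sumr ler_sum// => i _.
have [ji|ij] := leqP j i; first by rewrite ler_wpM2r ?sqr_ge0 ?ld.
by rewrite h// expr0n /= !mulr0.
Qed.

(** If [lambda k = lambda j], the orthonormal vectors [e j] and [e k] both lie in the eigenspace,
    whose rank is then at least 2. The decomposition is nonincreasing but may have ties, so
    simplicity has to be extracted from the rank. *)
Lemma simple_eigenvalue j k : \rank (eigenspace S (lambda j)) = 1%N ->
  k != j -> lambda k != lambda j.
Proof.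
move=> rk kj; apply/eqP => lkj.
have [_ oe specE] := specS.
(* [eigenspace] consists of row vectors, so the columns [e i] enter it through transposition and the
   symmetry of [S]. *)
have symS : S^T = S.
  rewrite specE linear_sum/=; apply: eq_bigr => i _.
  by rewrite linearZ/= trmx_mul trmxK.
have eig i : lambda i = lambda j -> ((e i)^T <= eigenspace S (lambda j))%MS.
  move=> li; apply/eigenspaceP.
  by rewrite -[in LHS]symS -trmx_mul spectral_eigen li linearZ.
have := mxrankS (_ : (col_mx (e j)^T (e k)^T <= eigenspace S (lambda j))%MS).
rewrite rk col_mx_sub !eig// => /(_ isT).
suff /eqP -> : row_free (col_mx (e j)^T (e k)^T) by [].
(* By orthonormality the columns [e j], [e k] form a right inverse of the stacked rows. *)
apply/row_freeP; exists (row_mx (e j) (e k)); rewrite mul_col_row.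
have dotM a b : (e a)^T *m e b = (a == b)%:R%:M.
  by rewrite -oe [LHS]mx11_scalar.
rewrite !dotM !eqxx (negPf kj) eq_sym (negPf kj).
by rewrite [RHS]scalar_mx_block !raddf0.
Qed.

End Spectral.

(* Courant-Fischer: the [d - 1] conditions [u _|_ e i] for [i > j] and
   [u _|_ e' i] for [i < j] have a common non-zero solution [u]. *)
Lemma eigenvalue_perturbation1 S S' (lambda lambda' : 'I_d -> R)
    (e e' : 'I_d -> 'cV[R]_d) (delta : R) j :
  spectral_decomposition S lambda e -> spectral_decomposition S' lambda' e' ->
  (forall i k, `|(S - S') i k| <= delta) ->
  lambda j - lambda' j <= d%:R ^+ 2 * delta.
Proof.
move=> sS sS' h.
(* The columns of [A] are the vectors that [u] must be orthogonal to. Column [j] is zero, so [A] is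
   singular and a non-zero row [v] with [v A = 0] provides [u = v^T]. *)
pose A : 'M[R]_d := \matrix_(k, i)
  if (i < j)%N then e' i k 0 else if (j < i)%N then e i k 0 else 0.
have /eqP/det0P[v v0 vA] : \det A = 0.
  rewrite (expand_det_col _ j) big1// => k _.
  by rewrite mxE !ltnn mul0r.
have dv (i : 'I_d) : dotcv v^T (if (i < j)%N then e' i else if (j < i)%N then e i else 0)
    = 0.
  have := congr1 (fun B : 'rV[R]_d => B 0 i) vA; rewrite !mxE => vAi.
  rewrite -[RHS]vAi dotcvE.
  apply: eq_bigr => k _; rewrite !mxE.
  by case: ifP => // _; case: ifP => // _; rewrite mxE.
have v0' : 0 < dotcv v^T v^T.
  apply: dotcv_gt0; apply: contra v0 => /eqP/(congr1 trmx).
  by rewrite trmxK trmx0 => ->.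
have le1 : lambda j * dotcv v^T v^T <= dotcv v^T (S *m v^T).
  apply: (spectral_quad_ge sS) => i ji.
  by have := dv i; rewrite ltnNge (ltnW ji)/= ji.
have le2 : dotcv v^T (S' *m v^T) <= lambda' j * dotcv v^T v^T.
  by apply: (spectral_quad_le sS') => i ji; have := dv i; rewrite ji.
have := quad_form_le v^T h.
rewrite mulmxBl -[- (S' *m _)]scaleN1r dotcvDr dotcvZr mulN1r => h2.
rewrite -(ler_pM2r v0') mulrBl.
apply: le_trans (le_trans (ler_norm _) h2).
by rewrite lerB.
Qed.

Lemma eigenvalue_perturbation S S' (lambda lambda' : 'I_d -> R)
    (e e' : 'I_d -> 'cV[R]_d) (delta : R) j :
  spectral_decomposition S lambda e -> spectral_decomposition S' lambda' e' ->
  (forall i k, `|(S' - S) i k| <= delta) ->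
  `|lambda' j - lambda j| <= d%:R ^+ 2 * delta.
Proof.
move=> sS sS' h; rewrite ler_norml lerNl opprB.
apply/andP; split; last exact: eigenvalue_perturbation1 sS' sS h.
apply: eigenvalue_perturbation1 sS sS' _ => i k.
by rewrite -opprB mxE normrN.
Qed.

(* With [c_k = e'_j . e_k], the vector [(S - lambda_j) e'_j] has squared norm
   [\sum_k (lambda_k - lambda_j)^2 c_k^2 >= g^2 (1 - c_j^2)], and
   [|e'_j - e_j|^2 = 2 (1 - c_j) <= 2 (1 - c_j^2)] because [0 <= c_j <= 1]. *)
Lemma eigenvector_perturbation S S' (lambda lambda' : 'I_d -> R)
    (e e' : 'I_d -> 'cV[R]_d) (delta g : R) j :
  spectral_decomposition S lambda e -> spectral_decomposition S' lambda' e' ->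
  (forall i k, `|(S' - S) i k| <= delta) -> 0 < g ->
  (forall k, k != j -> g <= `|lambda k - lambda j|) ->
  0 <= dotcv (e' j) (e j) ->
  enorm (e' j - e j) <= 4 * d%:R ^+ 3 * delta / g.
Proof.
move=> sS sS' h g0 gap c0.
have [_ oe _] := sS; have [_ oe' _] := sS'.
have d1 : 1 <= d%:R :> R by rewrite ler1n (leq_ltn_trans _ (ltn_ord j)).
have delta0 : 0 <= delta by apply: le_trans (h j j).
have n1 : enorm (e' j) = 1 by rewrite enorm_dot oe' eqxx sqrtr1.
pose x := e' j; pose w := S *m x - lambda j *: x.
have wE : w = (S - S') *m x + (lambda' j - lambda j) *: x.
  by rewrite mulmxBl (spectral_eigen sS') scalerBl addrA subrK.
(* Each coordinate is at most [d * delta], from [S - S'], plus [d^2 * delta], from the shift of the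
   eigenvalue; [d >= 1] bounds both by [d^2 * delta]. *)
have wle : dotcv w w <= d%:R * (2 * d%:R ^+ 2 * delta) ^+ 2.
  apply: dotcv_le_coord => k; rewrite wE mxE (le_trans (ler_normD _ _))//.
  rewrite [in leRHS]mulrAC -mulrA [leRHS]mulr_natl mulr2n lerD//.
    apply: (@le_trans _ _ (d%:R * delta * enorm x)).
      apply: mulmx_coord_le => i l.
      by rewrite -opprB mxE normrN.
    by rewrite n1 mulr1 mulrC ler_wpM2l// expr2 ler_peMl// (le_trans ler01).
  rewrite mxE normrM -[leRHS]mulr1 ler_pM//; last by rewrite -n1 coord_le_enorm.
  by rewrite mulrC; exact: eigenvalue_perturbation sS sS' h.
set c := dotcv x (e j).
have sumc : dotcv x x = 1 by rewrite oe' eqxx.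
have wge : g ^+ 2 * (1 - c ^+ 2) <= dotcv w w.
  rewrite -sumc !(dotcv_parseval oe) [in leLHS](bigD1 j)//= [leRHS](bigD1 j)//=.
  rewrite addrAC subrr add0r mulr_sumr.
  rewrite -[leLHS]add0r lerD ?sqr_ge0// ler_sum// => k kj.
  have -> : dotcv w (e k) = (lambda k - lambda j) * dotcv x (e k).
    by rewrite dotcvDl (spectral_dot sS) -scaleNr dotcvZl mulNr mulrBl.
  rewrite exprMn ler_wpM2r ?sqr_ge0// -(real_normK (num_real (_ - _))).
  by rewrite ler_pXn2r ?gap// nnegrE// ltW.
have c1 : c ^+ 2 <= 1.
  rewrite -sumc (dotcv_parseval oe) (bigD1 j)//= lerDl.
  by rewrite sumr_ge0// => k _; rewrite sqr_ge0.
have c1' : c <= 1 by rewrite -(@expr_le1 _ 2%N).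
apply: enorm_le; first by rewrite !mulr_ge0// invr_ge0 ltW.
have -> : dotcv (e' j - e j) (e' j - e j) = 2 * (1 - c).
  rewrite -scaleN1r !dotcvDl !dotcvDr !dotcvZl !dotcvZr oe oe' eqxx.
  by rewrite (dotcvC (e j)) -/x -/c /=; ring.
(* The estimates give [8 d^5 delta^2 / g^2] for the squared distance; since [d >= 1], the square of
   [4 d^3 delta / g] covers this without a square root in the constant. *)
have -> : (4 * d%:R ^+ 3 * delta / g) ^+ 2 =
    16 * d%:R ^+ 6 * delta ^+ 2 / g ^+ 2 by field; rewrite gt_eqF.
rewrite ler_pdivlMr ?exprn_gt0//.
apply: (@le_trans _ _ (2 * (g ^+ 2 * (1 - c ^+ 2)))).
  have gg : 0 < g ^+ 2 by rewrite exprn_gt0.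
  have : 0 <= 2 * (g ^+ 2 * ((1 - c) * c)).
    by rewrite !mulr_ge0 ?subr_ge0// ltW.
  by set G := g ^+ 2; nra.
apply: (@le_trans _ _ (2 * (d%:R * (2 * d%:R ^+ 2 * delta) ^+ 2))).
  by rewrite ler_pM2l// (le_trans wge).
have -> : 2 * (d%:R * (2 * d%:R ^+ 2 * delta) ^+ 2) =
  (8 * d%:R ^+ 5) * delta ^+ 2 :> R by ring.
rewrite ler_wpM2r ?sqr_ge0// [d%:R ^+ 6]exprS mulrA ler_wpM2r ?exprn_ge0//.
by move: d1; lra.
Qed.

End EuclideanVectors.

(** * Weak law for pairwise independent variables *)

Section PairwiseIndependence.
Context {R : realType} {disp : measure_display} {Omega : measurableType disp}.
Variable P : probability Omega R.

Lemma Lfun2P (X : Omega -> R) : measurable_fun setT X ->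
  ('E_P[fun w => (X w ^+ 2)%R] < +oo)%E -> X \in Lfun P 2%:E.
Proof.
move=> mX h; rewrite inE; apply/andP; split; rewrite inE//=.
rewrite /finite_norm unlock poweR_lty//.
apply: le_lt_trans h; rewrite unlock le_eqVlt; apply/orP; left; apply/eqP.
apply: eq_integral => w _ /=.
by rewrite powR_mulrn// real_normK// num_real.
Qed.

(** Independence says that the joint law agrees with the product of the marginals on rectangles;
    uniqueness of the product measure extends this to all measurable sets, and Fubini factors the
    integral. *)
Lemma expectation_indep_mul (X Y : {RV P >-> R}) :
  (X : Omega -> R) \in Lfun P 2%:E -> (Y : Omega -> R) \in Lfun P 2%:E ->
  (forall A B : set R, measurable A -> measurable B ->
    P (X @^-1` A `&` Y @^-1` B) = (P (X @^-1` A) * P (Y @^-1` B))%E) ->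
  ('E_P[X \* Y] = 'E_P[X] * 'E_P[Y])%E.
Proof.
move=> X2 Y2 indep.
have Pfin : P setT \is a fin_num := fin_num_measure P _ measurableT.
have X1 := Lfun_subset12 Pfin X2.
have Y1 := Lfun_subset12 Pfin Y2.
have /Lfun1_integrable XYi := Lfun2_mul_Lfun1 X2 Y2.
have mXY : measurable_fun setT (fun w => (X w, Y w)).
  exact/measurable_fun_pair.
pose Z : {mfun Omega >-> (R * R)%type} :=
  HB.pack (fun w => (X w, Y w)) (isMeasurableFun.Build _ _ _ _ _ mXY).
pose f (p : R * R) := (p.1 * p.2)%:E.
have mf : measurable_fun setT f.
  apply/measurable_EFinP; apply: measurable_funM.
  - exact: measurable_fst.
  - exact: measurable_snd.
have dE := @product_measure_unique _ _ _ _ R (distribution P X)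
  (distribution P Y) (distribution P Z) indep.
(* Fubini requires integrability under the product law; it is inherited from the joint law, under
   which the product of two square integrable variables is integrable. *)
have fi : (distribution P X \x distribution P Y)%E.-integrable setT f.
  have /integrableP[_ fi] : (distribution P Z).-integrable setT f.
    by apply: integrable_pushforward.
  apply/integrableP; split => //; apply: le_lt_trans fi.
  by rewrite le_eqVlt; apply/orP; left; apply/eqP;
    apply: eq_measure_integral => A mA _; exact: dE.
have -> : ('E_P[X \* Y] = \int[distribution P Z]_p f p)%E.
  by rewrite integral_distribution// unlock.
transitivity (\int[(distribution P X \x distribution P Y)%E]_p f p)%E.
  by apply: eq_measure_integral => A mA _; rewrite -dE.
rewrite -integral12_prod_meas1//.
have law_integral (W : {RV P >-> R}) : (W : Omega -> R) \in Lfun P 1 ->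
    (distribution P W).-integrable setT (EFin : R -> \bar R) /\
    ('E_P[W] = \int[distribution P W]_y y%:E)%E.
  move=> /Lfun1_integrable iW; split.
    by apply: integrable_pushforward => //; exact: EFin_measurable.
  rewrite unlock; apply/esym.
  exact: (@integral_distribution _ _ _ _ _ P W EFin _ iW); exact: EFin_measurable.
have [iX EXE] := law_integral X X1; have [iY EYE] := law_integral Y Y1.
rewrite /fubini_F /f /=.
under eq_integral do under eq_integral do rewrite EFinM.
under eq_integral => x _ do rewrite integralZl// -EYE.
rewrite -(fineK (expectation_fin_num Y1)).
by rewrite integralZr// EXE.
Qed.

Lemma expectation_same_law (X Y : {RV P >-> R}) (f : R -> R) :
  (forall A : set R, measurable A -> P (X @^-1` A) = P (Y @^-1` A)) ->
  measurable_fun setT f -> (f \o X : Omega -> R) \in Lfun P 1 ->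
  (f \o Y : Omega -> R) \in Lfun P 1 -> ('E_P[f \o X] = 'E_P[f \o Y])%E.
Proof.
move=> XY mf /Lfun1_integrable iX /Lfun1_integrable iY.
have mF : measurable_fun setT (EFin \o f) by exact/measurable_EFinP.
rewrite unlock -[LHS](@integral_distribution _ _ _ _ _ P X (EFin \o f))//.
rewrite -[RHS](@integral_distribution _ _ _ _ _ P Y (EFin \o f))//.
by apply: eq_measure_integral => A mA _; exact: XY.
Qed.

(** Nonnegativity replaces integrability here, so this version can transfer square integrability
    itself from [X0] to the [X i]. *)
Lemma ge0_expectation_same_law (X Y : {RV P >-> R}) (f : R -> R) :
  (forall A : set R, measurable A -> P (X @^-1` A) = P (Y @^-1` A)) ->
  measurable_fun setT f -> (forall x, 0 <= f x) ->
  ('E_P[f \o X] = 'E_P[f \o Y])%E.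
Proof.
move=> XY mf f0.
have mF : measurable_fun setT (EFin \o f) by exact/measurable_EFinP.
have F0 x : (0 <= (EFin \o f) x)%E by rewrite lee_fin.
rewrite unlock -[LHS](@ge0_integral_distribution _ _ _ _ _ P X (EFin \o f))//.
rewrite -[RHS](@ge0_integral_distribution _ _ _ _ _ P Y (EFin \o f))//.
by apply: eq_measure_integral => A mA _; exact: XY.
Qed.

Section IdenticallyDistributed.
Variables (X0 : {RV P >-> R}) (X : nat -> {RV P >-> R}).
Hypothesis X2 : (X0 : Omega -> R) \in Lfun P 2%:E.
Hypothesis law : forall i (A : set R), measurable A ->
  P (X i @^-1` A) = P (X0 @^-1` A).
Hypothesis indep : forall i j (A B : set R), (i < j)%N ->
  measurable A -> measurable B ->
  P (X i @^-1` A `&` X j @^-1` B) = (P (X i @^-1` A) * P (X j @^-1` B))%E.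

Let Pfin : P setT \is a fin_num := fin_num_measure P _ measurableT.

Let Xi2 i : (X i : Omega -> R) \in Lfun P 2%:E.
Proof.
apply: Lfun2P => //.
have := @ge0_expectation_same_law (X i) X0 (fun x => x ^+ 2) (law i)
  (exprn_measurable 2) (fun x => sqr_ge0 x).
rewrite /comp => ->; rewrite unlock.
have /integrableP[_] := Lfun2_integrable_sqr X2.
by under eq_integral do rewrite gee0_abs ?lee_fin ?sqr_ge0//.
Qed.

Let S n : Omega -> R := fun w => \sum_(i < n) X i w.

Let S0 : S 0 = cst 0.
Proof. by apply/funext => w; rewrite /S big_ord0. Qed.

Let SS n : S n.+1 = S n \+ X n.
Proof. by apply/funext => w; rewrite /S big_ord_recr. Qed.

Let S2 n : S n \in Lfun P 2%:E.
Proof.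
elim: n => [|n ih]; first by rewrite S0 Lfun_cst.
by rewrite SS rpredD// lee1n.
Qed.

Let EX i : ('E_P[X i] = 'E_P[X0])%E.
Proof.
apply: (@expectation_same_law (X i) X0 id (law i)) => //.
- exact: Lfun_subset12 (Xi2 i).
- exact: Lfun_subset12 X2.
Qed.

Let VX i : ('V_P[X i] = 'V_P[X0])%E.
Proof.
rewrite !varianceE// EX; congr (_ - _)%E.
exact: (@ge0_expectation_same_law (X i) X0 (fun x => x ^+ 2) (law i)
  (exprn_measurable 2) (fun x => sqr_ge0 x)).
Qed.

Let covX i j : (i < j)%N -> covariance P (X i) (X j) = 0%E.
Proof.
move=> ij; have Xi1 k := Lfun_subset12 Pfin (Xi2 k).
rewrite covarianceE//; last exact: Lfun2_mul_Lfun1.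
rewrite [X in (X - _)%E]expectation_indep_mul ?subee//.
  by rewrite fin_numM// expectation_fin_num.
by move=> A B; exact: indep.
Qed.

(** Keeping [m] fixed while [n] grows up to [m] makes each partial sum uncorrelated with the next
    variable, which is what the variance recursion [VS] uses. *)
Let covS n m : (n <= m)%N -> covariance P (S n) (X m) = 0%E.
Proof.
elim: n => [|n ih] nm; first by rewrite S0 covariance_cst_l.
by rewrite SS covarianceDl// ih ?(ltnW nm)// covX// adde0.
Qed.

Let VS n : ('V_P[S n] = n%:R%:E * 'V_P[X0])%E.
Proof.
elim: n => [|n ih]; first by rewrite S0 variance_cst mul0e.
rewrite SS varianceD// ih covS// mule0 adde0 VX.
by rewrite -[in RHS]addn1 natrD EFinD muleDl ?mul1e// variance_fin_num.
Qed.

Let ES n : ('E_P[S n] = n%:R%:E * 'E_P[X0])%E.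
Proof.
elim: n => [|n ih]; first by rewrite S0 expectation_cst mul0e.
have X1 := Lfun_subset12 Pfin X2.
rewrite SS expectationD ?ih ?EX; [|exact: (Lfun_subset12 Pfin)..].
by rewrite -[in RHS]addn1 natrD EFinD muleDl ?mul1e// expectation_fin_num.
Qed.

(** Chebyshev's inequality for the sum, whose variance is [n] times that of [X0]; the constant [K]
    is the same for all [n]. *)
Lemma sample_mean_tight (eps : R) : 0 < eps ->
  exists2 K : R, 0 < K & forall n, (0 < n)%N ->
    exists B : set Omega, [/\ measurable B, (P B <= eps%:E)%E &
      forall w, ~ B w ->
        `|n%:R^-1 * (\sum_(i < n) X i w) - fine ('E_P[X0])%E| <= K / Num.sqrt n%:R].
Proof.
move=> e0; have X1 := Lfun_subset12 Pfin X2.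
pose V := fine ('V_P[X0])%E.
have V0 : 0 <= V by rewrite fine_ge0// variance_ge0.
(* With this [K] Chebyshev's bound becomes [eps * V / (V + 1) <= eps]; the added 1 keeps [K]
   positive when the variance vanishes. *)
pose K := Num.sqrt ((V + 1) / eps).
have K2 : K ^+ 2 = (V + 1) / eps.
  by rewrite sqr_sqrtr// divr_ge0 ?ltW// ltr_wpDl.
have K0 : 0 < K by rewrite sqrtr_gt0 divr_gt0// ltr_wpDl.
exists K => // n n0.
have n0' : 0 < n%:R :> R by rewrite ltr0n.
have sn0 : 0 < Num.sqrt n%:R :> R by rewrite sqrtr_gt0.
have mS : measurable_fun setT (S n).
  by have := S2 n; rewrite inE => /andP[]; rewrite inE.
pose Sn : {RV P >-> R} := HB.pack (S n) (isMeasurableFun.Build _ _ _ _ _ mS).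
have Kn0 : 0 < K * Num.sqrt n%:R by rewrite mulr_gt0.
exists [set w | (K * Num.sqrt n%:R <= `|S n w - fine ('E_P[S n])%E|)%R]; split.
- rewrite -[X in measurable X]setTI.
  apply: measurable_fun_le => //.
  by apply: measurableT_comp => //; apply: measurable_funB.
- apply: le_trans (chebyshev Sn Kn0) _.
  rewrite [X in (_ * X)%E]VS -(fineK (variance_fin_num X2)) -/V -!EFinM lee_fin.
  rewrite exprMn K2 sqr_sqrtr ?(ltW n0')// invfM -mulrA mulKf ?gt_eqF// invf_div.
  rewrite mulrAC ler_pdivrMr ?ltr_wpDl//.
  by rewrite ler_wpM2l ?lerDl// ltW.
- move=> w /= /negP; rewrite -ltNge ES fineM// ?expectation_fin_num// => h.
  have -> : n%:R^-1 * (\sum_(i < n) X i w) - fine ('E_P[X0])%E =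
      n%:R^-1 * (S n w - n%:R * fine ('E_P[X0])%E).
    by rewrite mulrBr mulKf ?gt_eqF.
  rewrite normrM ger0_norm ?invr_ge0 ?(ltW n0')// mulrC ler_pdivrMr// mulrAC.
  rewrite ler_pdivlMr//.
  apply: le_trans (ler_wpM2r (ltW sn0) (ltW h)) _.
  by rewrite -mulrA -expr2 sqr_sqrtr// ltW.
Qed.

End IdenticallyDistributed.
End PairwiseIndependence.

(** * Borel structure of [L2] *)

Section L2Space.
Context {R : realType} {I : interval R}.
Implicit Types f g h : L2 I.

Notation mu := (mrestr (@lebesgue_measure R) (measurable_itv I)).

Lemma measurable_L2fun f :
  @measurable_fun _ _ (measurableTypeR R) R setT (L2fun f).
Proof.
rewrite /L2fun /aqEqMfun_to_fun => mT B mB.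
set g := repr _; exact: (@measurable_funP _ _ _ _ setT g mT B mB).
Qed.

Lemma L2fun_finite f : ('N[mu]_2%:E[EFin \o L2fun f] < +oo)%E.
Proof. exact: (@Lebesgue_finite _ _ _ _ _ _ f). Qed.

(** Minkowski's inequality makes the norm of the difference finite, so [fine] discards nothing and
    facts about extended real norms apply to [L2dist]. *)
Lemma L2distE f g :
  ((L2dist f g)%:E = 'N[mu]_2%:E[EFin \o (L2fun f \- L2fun g)%R])%E.
Proof.
rewrite /L2dist fineK// ge0_fin_numE ?Lnorm_ge0//.
have mg : @measurable_fun _ _ (measurableTypeR R) R setT (\- L2fun g).
  by apply: measurableT_comp => //; exact: measurable_L2fun.
have := minkowski_EFin mu (measurable_L2fun f) mg (ler1n R 2).
move=> /le_lt_trans; apply.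
rewrite lte_add_pinfty ?L2fun_finite//.
have -> : (EFin \o (\- L2fun g)%R = \- (EFin \o L2fun g))%E by [].
by rewrite oppe_Lnorm L2fun_finite.
Qed.

Lemma L2dist_triangle f g h : L2dist f h <= L2dist f g + L2dist g h.
Proof.
rewrite -lee_fin EFinD !L2distE.
have mB (k l : L2 I) :
    @measurable_fun _ _ (measurableTypeR R) R setT (L2fun k \- L2fun l).
  exact: measurable_funB (measurable_L2fun k) (measurable_L2fun l).
have := minkowski_EFin mu (mB f g) (mB g h) (ler1n R 2).
apply: le_trans; rewrite le_eqVlt; apply/orP; left; apply/eqP.
by apply: eq_Lnorm => t /=; rewrite addrA subrK.
Qed.

Lemma L2dist_xx f : L2dist f f = 0.
Proof.
apply: EFin_inj; rewrite L2distE -[RHS](@Lnorm0 _ _ _ mu 2%:E) ?eqe//.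
by apply: eq_Lnorm => t /=; rewrite subrr.
Qed.

Definition real_continuous_on (M : set (L2 I)) (F : L2 I -> R) :=
  dist_continuous (@L2dist R I) (fun x y : R => `|x - y|) M F.

(* Only the traces on [M] of Borel sets of [L2 I] matter, because [M] is not
   known to be Borel. *)
Lemma borel_preimage (M : set (L2 I)) (F : L2 I -> R) (B : set R) :
  real_continuous_on M F -> measurable B ->
  exists2 A, L2borel A & forall f, M f -> (A f <-> B (F f)).
Proof.
(* Good sets principle: [G] is a sigma-algebra, so it suffices to treat the open rays that generate
   the Borel sets of the line. *)
move=> cF; pose G := [set B : set R |
  exists2 A, L2borel A & forall f, M f -> (A f <-> B (F f))].
have [borel0 borelD borelU] :
  sigma_algebra setT (@L2borel R I) by exact: smallest_sigma_algebra.
have Gsigma : sigma_algebra setT G.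
  split.
  - by exists set0.
  - move=> C [A bA AC]; exists (setT `\` A); first exact: borelD.
    move=> f Mf; have [AC1 AC2] := AC f Mf.
    by split => -[_ nA]; split => // h; apply: nA; [exact: AC2|exact: AC1].
  - move=> C GC.
    have [A bA AC] : exists2 A : nat -> set (L2 I), (forall n, L2borel (A n)) &
        forall n f, M f -> (A n f <-> C n (F f)).
      have /choice[A hA] : forall n, exists A, L2borel A /\
          forall f, M f -> (A f <-> C n (F f)).
        by move=> n; have [A ? ?] := GC n; exists A.
      by exists A => n; have [] := hA n.
    exists (\bigcup_k A k); first exact: borelU.
    move=> f Mf; split => -[k _ h]; exists k => //; first exact/(AC k f Mf).
    exact/(AC k f Mf).
suff : (@ocitv R).-sigma.-measurable `<=` G by move=> /(_ B).
rewrite RGenOInfty.measurableE; apply: smallest_sub => // _ [x ->].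
(* [V] is open in the whole of [L2 I] by the triangle inequality, and continuity on [M] makes its
   trace on [M] the preimage of the ray above [x]. *)
pose V := [set f | exists2 r : R, 0 < r &
  forall g, M g -> L2dist f g < r -> x < F g].
exists V.
  apply: sub_sigma_algebra => f /= [r r0 Vf].
  exists r => // g fg; exists (r - L2dist f g); first by rewrite subr_gt0.
  move=> k Mk gk; apply: Vf => //; apply: le_lt_trans (L2dist_triangle f g k) _.
  by rewrite addrC -ltrBrDr.
move=> f Mf; rewrite /= in_itv/= andbT; split.
  by move=> [r r0]; apply => //; rewrite L2dist_xx.
move=> xF; have eps0 : 0 < F f - x by rewrite subr_gt0.
have [r r0 hr] := cF f Mf _ eps0; exists r => // g Mg fg.
by have := hr g Mg fg; rewrite ltr_norml => /andP[_]; lra.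
Qed.

Lemma real_continuous_onM (M : set (L2 I)) (F G : L2 I -> R) :
  real_continuous_on M F -> real_continuous_on M G ->
  real_continuous_on M (F \* G).
Proof.
move=> cF cG f Mf eps eps0.
(* Chosen so that the two linear terms of the product increment and a further [a] add up to
   [eps / 2]. Capping the increments by 1 as well bounds the quadratic term by that [a]. *)
pose a := eps / 2 / (`|F f| + `|G f| + 1).
have s0 : 0 < `|F f| + `|G f| + 1 by rewrite ltr_wpDl// addr_ge0.
have a0 : 0 < a by rewrite !divr_gt0.
pose b := Num.min a 1; have b0 : 0 < b by rewrite lt_min a0 ltr01.
have [r r0 hr] := cF f Mf b b0; have [s s0' hs] := cG f Mf b b0.
exists (Num.min r s); first by rewrite lt_min r0 s0'.
move=> g Mg; rewrite lt_min => /andP[/(hr g Mg) + /(hs g Mg)].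
rewrite /b !lt_min => /andP[Fa _] /andP[Ga G1] /=.
have -> : F f * G f - F g * G g =
  F f * (G f - G g) + (F f - F g) * G f - (F f - F g) * (G f - G g) by ring.
apply: le_lt_trans (ler_normB _ _) _.
apply: (@le_lt_trans _ _ (`|F f| * a + a * `|G f| + a * 1)).
  rewrite lerD ?(le_trans (ler_normD _ _))// ?normrM; last first.
    by rewrite ler_pM// ltW.
  by rewrite lerD// ?normrM; [rewrite ler_wpM2l// ltW|rewrite ler_wpM2r// ltW].
have -> : `|F f| * a + a * `|G f| + a * 1 = eps / 2.
  by rewrite /a; field; rewrite gt_eqF.
by rewrite ltr_pdivrMr// ltr_pMr// ltr1n.
Qed.

Lemma coord_continuous (d : nat) (M : set (L2 I)) (psi : L2 I -> 'cV[R]_d) k :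
  representation_map M psi -> real_continuous_on M (fun f => psi f k 0).
Proof.
move=> [phi [_ _ _ cpsi]] f Mf eps eps0.
have [r r0 hr] := cpsi f Mf eps eps0; exists r => // g Mg fg.
apply: le_lt_trans (hr g Mg fg).
by have := coord_le_enorm (psi f - psi g) k; rewrite !mxE.
Qed.

(** * Continuous functionals of random functions with values in [M] *)

Section Samples.
Context {disp : measure_display} {Omega : measurableType disp}.
Variables (P : probability Omega R) (M : set (L2 I)).

Lemma measurable_continuous_of (X : Omega -> L2 I) (F : L2 I -> R) :
  random_function X -> (forall w, M (X w)) -> real_continuous_on M F ->
  measurable_fun setT (F \o X).
Proof.
move=> rX MX cF _ B mB; rewrite setTI.
have [A bA AB] := borel_preimage cF mB.
have -> : (F \o X) @^-1` B = X @^-1` A.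
  by apply/seteqP; split => w /=; have [? ?] := AB (X w) (MX w).
exact: rX.
Qed.

Lemma independent_functions_pair (X : nat -> Omega -> L2 I) (i j : nat)
    (A B : set (L2 I)) :
  (forall k, random_function (X k)) -> independent_functions P X ->
  (i < j)%N -> L2borel A -> L2borel B ->
  (P (X i @^-1` A `&` X j @^-1` B) = P (X i @^-1` A) * P (X j @^-1` B))%E.
Proof.
move=> rX indX ij bA bB.
(* The product rule is applied to the first [j + 1] functions, with the whole space in every
   position other than [i] and [j]. *)
pose C (k : 'I_j.+1) : set (L2 I) :=
  if k == i :> nat then A else if k == j :> nat then B else setT.
have [_ borelD _] :
  sigma_algebra setT (@L2borel R I) by exact: smallest_sigma_algebra.
have borelT : L2borel [set: L2 I].
  by rewrite -[setT]setD0; apply: borelD; exact: sigma_algebra0.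
have bC k : L2borel (C k) by rewrite /C; case: ifP => //; case: ifP.
have ltij : (i < j.+1)%N by rewrite ltnS ltnW.
pose i' := Ordinal ltij; pose j' := @ord_max j.
have ji' : j' != i' by rewrite -val_eqE /= gtn_eqF.
have Ci : C i' = A by rewrite /C eqxx.
have Cj : C j' = B by rewrite /C /= gtn_eqF// eqxx.
have Ck k : k != i' -> k != j' -> C k = setT.
  by rewrite -!val_eqE /= /C => /negPf -> /negPf ->.
have := indX _ C bC.
have -> : [set w | forall k : 'I_j.+1, C k (X k w)] =
    X i @^-1` A `&` X j @^-1` B.
  apply/seteqP; split => [w h|w [wA wB] k /=].
    by split => /=; [have := h i'; rewrite Ci|have := h j'; rewrite Cj].
  have [->|ki] := eqVneq k i'; first by rewrite Ci.
  have [->|kj] := eqVneq k j'; first by rewrite Cj.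
  by rewrite Ck.
move=> ->; rewrite (bigD1 i')//= (bigD1 j')//= Ci Cj big1 ?mulr1; last first.
  by move=> k /andP[ki kj]; rewrite Ck// preimage_setT probability_setT.
by rewrite EFinM !fineK//; apply: fin_num_measure; exact: rX.
Qed.

(** All sample functions lie in [M], so events about [F (Xs i)] are events about [Xs i] and Borel
    sets of [L2 I]; equality of laws and pairwise independence thus pass to the real variables. *)
Lemma continuous_sample_mean_tight (X : Omega -> L2 I)
    (Xs : nat -> Omega -> L2 I) (F : L2 I -> R) (eps : R) :
  random_function X -> (forall w, M (X w)) ->
  (forall i, random_function (Xs i)) -> (forall i w, M (Xs i w)) ->
  independent_functions P Xs -> (forall i, same_distribution P (Xs i) X) ->
  real_continuous_on M F -> ('E_P[fun w => (F (X w) ^+ 2)%R] < +oo)%E ->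
  0 < eps ->
  exists2 K : R, 0 < K & forall n, (0 < n)%N ->
    exists B : set Omega, [/\ measurable B, (P B <= eps%:E)%E &
      forall w, ~ B w ->
        `|n%:R^-1 * (\sum_(i < n) F (Xs i w)) - fine ('E_P[F \o X])%E|
        <= K / Num.sqrt n%:R].
Proof.
move=> rX MX rXs MXs indX law cF F2 eps0.
have mX := measurable_continuous_of rX MX cF.
have mXs i := measurable_continuous_of (rXs i) (MXs i) cF.
pose U0 : {RV P >-> R} := HB.pack (F \o X) (isMeasurableFun.Build _ _ _ _ _ mX).
pose U i : {RV P >-> R} :=
  HB.pack (F \o Xs i) (isMeasurableFun.Build _ _ _ _ _ (mXs i)).
have pre (Y : Omega -> L2 I) (A : set (L2 I)) (B : set R) :
    (forall w, M (Y w)) -> (forall f, M f -> (A f <-> B (F f))) ->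
    (F \o Y) @^-1` B = Y @^-1` A.
  by move=> MY AB; apply/seteqP; split => w /=; have [? ?] := AB (Y w) (MY w).
apply: (@sample_mean_tight _ _ _ P U0 U _ _ _ eps eps0).
- exact: Lfun2P.
- move=> i B mB; have [A bA AB] := borel_preimage cF mB.
  by rewrite /= !(pre _ A B)//; exact: law.
- move=> i j B B' ij mB mB'.
  have [A bA AB] := borel_preimage cF mB.
  have [A' bA' AB'] := borel_preimage cF mB'.
  rewrite /= !(pre _ A B)// !(pre _ A' B')//.
  exact: independent_functions_pair.
Qed.

End Samples.
End L2Space.

(** * Measurability and control of the maximal error *)

Section MaximalError.
Context {R : realType} {disp : measure_display} {Omega : measurableType disp}.

Lemma measurable_enorm (d : nat) (Y : Omega -> 'cV[R]_d) :
  random_vector Y -> measurable_fun setT (fun w => enorm (Y w)).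
Proof.
move=> rY.
have mS : measurable_fun setT (fun w => \sum_(k < d) Y w k 0 ^+ 2).
  by apply: measurable_sum => k; apply: measurable_funX; exact: rY.
exact: measurableT_comp (continuous_measurable_fun (@sqrt_continuous R)) mS.
Qed.

Lemma measurable_bigmax (n : nat) (F : 'I_n -> Omega -> R) :
  (forall i, measurable_fun setT (F i)) ->
  measurable_fun setT (fun w => \big[Num.max/0]_(i < n) F i w).
Proof.
move=> mF.
suff H s : measurable_fun setT (fun w => \big[Num.max/0]_(i <- s) F i w).
  exact: H.
elim: s => [|i s ih].
  under eq_fun do rewrite big_nil; exact: measurable_cst.
by under eq_fun do rewrite big_cons; exact: measurable_maxr.
Qed.

(** The rate contains [v_n] itself, so what is wanted is a bound by 1 that absorbs quadratic error
    terms into linear ones. Markov's inequality at level 1 provides it. *)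
Lemma markov_near (P : probability Omega R) (V : nat -> Omega -> R) (eps : R) :
  (forall n, measurable_fun setT (V n)) -> (forall n w, 0 <= V n w) ->
  ('E_P[V n])%E @[n --> \oo] --> 0%E -> 0 < eps ->
  \forall n \near \oo, exists B : set Omega,
    [/\ measurable B, (P B <= eps%:E)%E & forall w, ~ B w -> V n w <= 1].
Proof.
move=> mV V0 EV eps0.
have : \forall n \near \oo, ('E_P[V n] < eps%:E)%E.
  have := @open_ereal_lt' R 0%E eps%:E; rewrite lte_fin => /(_ eps0) h.
  exact: (EV _ h).
apply: filterS => n En.
exists [set w | 1 <= V n w]; split.
- rewrite -[X in measurable X]setTI.
  exact: measurable_fun_le.
- pose W : {RV P >-> R} := HB.pack (V n) (isMeasurableFun.Build _ _ _ _ _ (mV n)).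
  have -> : [set w | 1 <= V n w] = [set w | (1%:E <= `|(W w)%:E|)%E].
    by apply/seteqP; split => w /=; rewrite lee_fin ger0_norm.
  have := @markov _ _ _ P W id 1 ltr01 (@measurable_id _ _ _) (fun _ h => h)
    (fun x y _ _ h => h).
  rewrite mul1e => /le_trans; apply.
  apply: le_trans (ltW En); rewrite le_eqVlt; apply/orP; left; apply/eqP.
  by congr expectation; apply/funext => w /=; rewrite ger0_norm.
- by move=> w /= /negP; rewrite -ltNge => /ltW.
Qed.

End MaximalError.

(** * Moments of the perturbed sample *)

Section SampleMoments.
Context {R : realType} {d n : nat}.
(** The setting is deterministic: one outcome is fixed, [y] and [yh] are the true and the estimated
    sample, [m] and [s] the population moments of first and second order, and [r] is the parametric
    rate. *)
Variables (y yh : 'I_n -> 'cV[R]_d) (m : 'I_d -> R) (s : 'I_d -> 'I_d -> R).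
Variables (v K : R).
Let r : R := 1 / Num.sqrt n%:R.
Hypothesis n1 : (1 < n)%N.
Hypothesis K0 : 0 <= K.
Hypothesis v0 : 0 <= v.
Hypothesis close : forall i, enorm (yh i - y i) <= v.
Hypothesis mean1 : forall k,
  `|n%:R^-1 * (\sum_i y i k 0) - m k| <= K / Num.sqrt n%:R.

Let av (f : 'I_n -> R) : R := n%:R^-1 * \sum_i f i.

Let n0 : 0 < n%:R :> R. Proof. by rewrite ltr0n ltnW. Qed.

Let r0 : 0 < r. Proof. by rewrite divr_gt0// sqrtr_gt0. Qed.

Let r1 : r <= 1.
Proof.
rewrite /r ler_pdivrMr ?sqrtr_gt0// mul1r -[leLHS]sqrtr1 ler_wsqrtr//.
by rewrite ler1n ltnW.
Qed.

Let av_le f g : (forall i, f i <= g i) -> av f <= av g.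
Proof.
by move=> fg; rewrite ler_pM2l ?invr_gt0// ler_sum.
Qed.

Let avD f g : av (fun i => f i + g i) = av f + av g.
Proof. by rewrite /av big_split mulrDr. Qed.

Let avB f g : av (fun i => f i - g i) = av f - av g.
Proof. by rewrite /av sumrB mulrBr. Qed.

Let avZ c f : av (fun i => c * f i) = c * av f.
Proof. by rewrite /av -mulr_sumr mulrCA. Qed.

Let av_cst c : av (fun=> c) = c.
Proof. by rewrite /av sumr_const card_ord -[c *+ n]mulr_natl mulKf ?gt_eqF. Qed.

Let av_norm f : `|av f| <= av (fun i => `|f i|).
Proof.
rewrite /av normrM ger0_norm ?invr_ge0 ?(ltW n0)//.
by rewrite ler_pM2l ?invr_gt0// ler_norm_sum.
Qed.

Let coord_close i k : `|yh i k 0 - y i k 0| <= v.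
Proof.
apply: le_trans (close i).
by have := coord_le_enorm (yh i - y i) k; rewrite !mxE.
Qed.

Lemma sample_mean_coord_bound k :
  `|av (fun i => yh i k 0) - m k| <= (1 + K) * (v + r).
Proof.
have -> : av (fun i => yh i k 0) - m k =
    av (fun i => yh i k 0 - y i k 0) + (av (fun i => y i k 0) - m k).
  by rewrite avB; ring.
apply: le_trans (ler_normD _ _) _.
apply: (@le_trans _ _ (v + K * r)).
  rewrite lerD//; last by rewrite /r mul1r; exact: mean1.
  by apply: le_trans (av_norm _) _; rewrite -[leRHS]av_cst; exact: av_le.
have : 0 <= K * v by rewrite mulr_ge0.
by move: r0; lra.
Qed.

Lemma sample_mean_bound (mu : 'cV[R]_d) : (forall k, mu k 0 = m k) ->
  enorm (sample_mean yh - mu) <= d%:R * ((1 + K) * (v + r)).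
Proof.
move=> muE; apply: enorm_le_coord.
  by rewrite mulr_ge0 ?addr_ge0// ltW.
move=> k; rewrite !mxE summxE muE; exact: sample_mean_coord_bound.
Qed.

Variable T : R.
Hypothesis v1 : v <= 1.
Hypothesis T0 : 0 <= T.
Hypothesis mT : forall k, `|m k| <= T.
Hypothesis sT : forall k l, `|s k l| <= T.
Hypothesis mean2 : forall k l,
  `|n%:R^-1 * (\sum_i y i k 0 * y i l 0) - s k l| <= K / Num.sqrt n%:R.

(** Since [|a| <= 1 + a^2], the second moment controls the first absolute one; it is at most [T + K]
    because [r <= 1]. *)
Let av_abs_le k : av (fun i => `|y i k 0|) <= 1 + T + K.
Proof.
apply: (@le_trans _ _ (av (fun i => 1 + y i k 0 * y i k 0))).
  apply: av_le => i; rewrite -expr2 -(real_normK (num_real (y i k 0))).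
  by have := sqr_ge0 (`|y i k 0| - 1); set a := `|_|; nra.
rewrite avD av_cst -addrA lerD2l.
have := le_trans (ler_norm _) (mean2 k k).
have := le_trans (ler_norm _) (sT k k).
have : K / Num.sqrt n%:R <= K.
  by rewrite -[leRHS]mulr1 ler_wpM2l//; move: r1; rewrite /r mul1r.
rewrite -/(av (fun i => y i k 0 * y i k 0)).
by move=> h1 h2 h3; move: h1 h2 h3; lra.
Qed.

Let second_moment_bound k l :
  `|av (fun i => yh i k 0 * yh i l 0) - s k l| <=
  (3 + 2 * T + 3 * K) * (v + r).
Proof.
have -> : av (fun i => yh i k 0 * yh i l 0) - s k l =
    av (fun i => yh i k 0 * yh i l 0 - y i k 0 * y i l 0) +
    (av (fun i => y i k 0 * y i l 0) - s k l).
  by rewrite avB; ring.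
apply: le_trans (ler_normD _ _) _.
(* The factor of [v] is [2 (1 + T + K) + 1]: two average absolute coordinates, and 1 for the
   quadratic error, where [v^2 <= v]. *)
apply: (@le_trans _ _ (v * (3 + 2 * T + 2 * K) + K * r)).
  rewrite lerD//; last by rewrite /r mul1r; exact: mean2.
  apply: le_trans (av_norm _) _.
  apply: (@le_trans _ _ (av (fun i => v * (`|y i k 0| + `|y i l 0| + 1)))).
    apply: av_le => i.
    have -> : yh i k 0 * yh i l 0 - y i k 0 * y i l 0 =
      (yh i k 0 - y i k 0) * y i l 0 + (yh i l 0 - y i l 0) * y i k 0 +
      (yh i k 0 - y i k 0) * (yh i l 0 - y i l 0) by ring.
    have -> : v * (`|y i k 0| + `|y i l 0| + 1) =
      v * `|y i l 0| + v * `|y i k 0| + v * 1 by ring.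
    rewrite (le_trans (ler_normD _ _))// lerD//.
      apply: le_trans (ler_normD _ _) _.
      by apply: lerD; rewrite normrM; apply: ler_wpM2r.
    by rewrite normrM ler_pM// (le_trans (coord_close _ _)).
  rewrite avZ ler_wpM2l// !avD av_cst.
  by move: (av_abs_le k) (av_abs_le l); lra.
have h1 : 0 <= K * v by rewrite mulr_ge0.
have h2 : 0 <= (3 + 2 * T + 2 * K) * r.
  by apply: mulr_ge0; [rewrite !addr_ge0// mulr_ge0|exact: ltW].
by move: h1 h2; lra.
Qed.

Let product_bound k l :
  `|av (fun i => yh i k 0) * av (fun i => yh i l 0) - m k * m l| <=
  (1 + K) * (2 * T + 2 * (1 + K)) * (v + r).
Proof.
set a := av (fun i => yh i k 0); set b := av (fun i => yh i l 0).
have ak : `|a - m k| <= (1 + K) * (v + r) := sample_mean_coord_bound k.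
have bl : `|b - m l| <= (1 + K) * (v + r) := sample_mean_coord_bound l.
have rho0 : 0 <= v + r by rewrite addr_ge0// ltW.
have K1 : 0 <= 1 + K by rewrite addr_ge0.
(* Here [v + r <= 2] turns the error bound into a constant. *)
have bT : `|b| <= T + 2 * (1 + K).
  rewrite -[b](subrK (m l)) addrC (le_trans (ler_normD _ _))// lerD//.
  rewrite (le_trans bl)// [leRHS]mulrC ler_wpM2l//.
  by move: v1 r1; lra.
have -> : a * b - m k * m l = (a - m k) * b + m k * (b - m l) by ring.
apply: le_trans (ler_normD _ _) _.
rewrite (normrM (a - m k)) (normrM (m k)).
apply: (@le_trans _ _ ((1 + K) * (v + r) * (T + 2 * (1 + K)) +
                       T * ((1 + K) * (v + r)))).
  by apply: lerD; apply: ler_pM.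
by rewrite le_eqVlt; apply/orP; left; apply/eqP; ring.
Qed.

Lemma sample_cov_bound k l :
  `|sample_cov yh k l - (s k l - m k * m l)| <=
  (2 * ((3 + 2 * T + 3 * K) + (1 + K) * (2 * T + 2 * (1 + K)))
   + 2 * (T + T ^+ 2)) * (v + r).
Proof.
have rho0 : 0 <= v + r by rewrite addr_ge0// ltW.
have n1' : 1 < n%:R :> R by rewrite ltr1n.
have n2 : 2 <= n%:R :> R by rewrite (ler_nat _ 2 n).
have nn1 : 0 < n%:R - 1 :> R by rewrite subr_gt0.
set q := av (fun i => yh i k 0 * yh i l 0).
set a := av (fun i => yh i k 0); set b := av (fun i => yh i l 0).
set sg := s k l - m k * m l.
have covE : sample_cov yh k l = n%:R / (n%:R - 1) * (q - a * b).
  rewrite !mxE summxE big_ord1 !mxE !summxE.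
  under eq_bigr do rewrite mxE big_ord1 [_^T _ _]mxE.
  rewrite /q /a /b /av.
  by field; rewrite !gt_eqF.
(* The last term is the bias caused by dividing by [n - 1] instead of [n]. *)
have -> : sample_cov yh k l - sg =
    n%:R / (n%:R - 1) * (q - a * b - sg) + sg / (n%:R - 1).
  by rewrite covE; field; rewrite gt_eqF.
have qab : `|q - a * b - sg| <=
    ((3 + 2 * T + 3 * K) + (1 + K) * (2 * T + 2 * (1 + K))) * (v + r).
  have -> : q - a * b - sg = (q - s k l) - (a * b - m k * m l).
    by rewrite /sg; ring.
  rewrite mulrDl (le_trans (ler_normB _ _))// lerD//.
    exact: second_moment_bound.
  exact: product_bound.
have sgT : `|sg| <= T + T ^+ 2.
  by rewrite (le_trans (ler_normB _ _))// lerD// normrM expr2 ler_pM.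
have c2 : n%:R / (n%:R - 1) <= 2 :> R.
  by rewrite ler_pdivrMr//; lra.
have c0 : 0 <= n%:R / (n%:R - 1) :> R by rewrite divr_ge0// ltW.
(* For [n >= 2] one has [1 / (n - 1) <= 2 / n = 2 r^2 <= 2 r], so the bias is within the rate. *)
have inv_le : (n%:R - 1)^-1 <= 2 * (v + r) :> R.
  apply: (@le_trans _ _ (2 * r)); last by rewrite ler_pM2l// lerDr.
  have rr : r * r = n%:R^-1.
    by rewrite /r mul1r -invfM -expr2 sqr_sqrtr// ltW.
  apply: (@le_trans _ _ (2 * (r * r))).
    rewrite rr -[leLHS]mul1r ler_pdivrMr// mulrAC ler_pdivlMr//; lra.
  by rewrite ler_pM2l// ler_piMr// ltW.
rewrite [leRHS]mulrDl (le_trans (ler_normD _ _))// lerD//.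
  by rewrite normrM (ger0_norm c0) -[leRHS]mulrA ler_pM.
have inv0 : 0 <= (n%:R - 1)^-1 :> R by rewrite invr_ge0 ltW.
by rewrite normrM (ger0_norm inv0) [leRHS]mulrAC mulrC ler_pM.
Qed.

End SampleMoments.

(** * Bounds holding with high probability *)

Section Tightness.
Context {R : realType} {disp : measure_display} {Omega : measurableType disp}.
Variable P : probability Omega R.

(* [K] is the constant of the bound [Q] at hand, hence the condition [upward]
   below: enlarging it only weakens the bound. *)
Definition tight (Q : R -> nat -> Omega -> Prop) : Prop :=
  forall eps : R, 0 < eps -> exists K : R, \forall n \near \oo,
    exists B : set Omega,
      [/\ measurable B, (P B <= eps%:E)%E & forall w, ~ B w -> Q K n w].

Definition upward (Q : R -> nat -> Omega -> Prop) : Prop :=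
  forall K K' n w, K <= K' -> Q K n w -> Q K' n w.

Lemma upward_and Q1 Q2 : upward Q1 -> upward Q2 ->
  upward (fun K n w => Q1 K n w /\ Q2 K n w).
Proof.
move=> u1 u2 K K' n w KK' [q1 q2].
by split; [exact: u1 KK' q1|exact: u2 KK' q2].
Qed.

Lemma upward_forall (T : Type) (Q : T -> R -> nat -> Omega -> Prop) :
  (forall t, upward (Q t)) -> upward (fun K n w => forall t, Q t K n w).
Proof. by move=> u K K' n w KK' q t; exact: u KK' (q t). Qed.

Lemma tight_and Q1 Q2 : upward Q1 -> upward Q2 -> tight Q1 -> tight Q2 ->
  tight (fun K n w => Q1 K n w /\ Q2 K n w).
Proof.
move=> u1 u2 t1 t2 eps eps0; have eps2 : 0 < eps / 2 by rewrite divr_gt0.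
have [K1 h1] := t1 _ eps2; have [K2 h2] := t2 _ eps2.
exists (Num.max K1 K2); apply: filterS2 h1 h2 => n [B1 [m1 p1 q1]] [B2 [m2 p2 q2]].
exists (B1 `|` B2); split; first exact: measurableU.
- apply: le_trans (measureU2 _ _ _) _ => //.
  by rewrite [eps]splitr EFinD leeD.
- move=> w /not_orP[/q1 h1 /q2 h2]; split.
    by apply: u1 h1; rewrite le_max lexx.
  by apply: u2 h2; rewrite le_max lexx orbT.
Qed.

Lemma tight_forall (T : finType) (Q : T -> R -> nat -> Omega -> Prop) :
  (forall t, upward (Q t)) -> (forall t, tight (Q t)) ->
  tight (fun K n w => forall t, Q t K n w).
Proof.
move=> u h.
suff H (s : seq T) : tight (fun K n w => forall t, t \in s -> Q t K n w).
  move=> eps /(H (enum T))[K HK]; exists K; apply: filterS HK => n [B [mB PB QB]].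
  by exists B; split => // w nB t; apply: QB => //; rewrite mem_enum.
elim: s => [|t s ih].
  move=> eps eps0; exists 0; apply: nearW => n; exists set0.
  by split => //; rewrite measure0 lee_fin ltW.
have us : upward (fun K n w => forall t, t \in s -> Q t K n w).
  by move=> K K' n w KK' H t' ts; apply: u KK' _; exact: H.
move=> eps /(tight_and (u t) us (h t) ih)[K HK]; exists K.
apply: filterS HK => n [B [mB PB QB]]; exists B; split => // w nB t'.
have [Q1 Q2] := QB w nB.
by rewrite inE => /predU1P[->//|]; exact: Q2.
Qed.

(** Turns a deterministic estimate valid off the exceptional event into a rate: [C] may depend on
    [K], but not on [n] or the outcome. *)
Lemma tight_bigOp (Q : R -> nat -> Omega -> Prop) (Z a : nat -> Omega -> R) :
  tight Q -> (forall n w, (1 < n)%N -> 0 < a n w) ->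
  (forall K, exists C, forall n w, (1 < n)%N -> Q K n w ->
    `|Z n w| <= C * a n w) ->
  bigOp P Z a.
Proof.
move=> tQ a0 QZ eps /tQ[K HK]; have [C HC] := QZ K; exists C.
have n1 : \forall n \near \oo, (1 < n)%N by exists 2%N.
apply: filterS2 n1 HK => n n1 [B [mB PB QB]]; exists B; split => // w /=.
have aw := a0 n w n1.
apply: contraPP => /QB /(HC n w n1) Zle; apply/negP.
by rewrite -leNgt normrM normfV (gtr0_norm aw) ler_pdivrMr.
Qed.

End Tightness.

(** * Population moments, spectral gap and the rates *)

Lemma expectation_dominated {R : realType} {disp : measure_display}
    {Omega : measurableType disp} (P : probability Omega R)
    (F G H : Omega -> R) :
  measurable_fun setT F -> measurable_fun setT G -> measurable_fun setT H ->
  (forall w, 0 <= F w) -> (forall w, 0 <= G w) -> (forall w, 0 <= H w) ->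
  (forall w, H w <= F w + G w) ->
  ('E_P[F] < +oo)%E -> ('E_P[G] < +oo)%E -> ('E_P[H] < +oo)%E.
Proof.
move=> mF mG mH F0 G0 H0 HFG EF EG.
apply: (@le_lt_trans _ _ ('E_P[F] + 'E_P[G])%E); last exact: lte_add_pinfty.
rewrite unlock -ge0_integralD//; try exact/measurable_EFinP;
  try by move=> w _; rewrite lee_fin.
apply: ge0_le_integral => //; try exact/measurable_EFinP;
  try by move=> w _; rewrite lee_fin ?addr_ge0.
by apply: emeasurable_funD; exact/measurable_EFinP.
Qed.

(** Square integrability makes all expectations involved finite, so [fine] commutes with the product
    and the difference. *)
Lemma cov_mxE {R : realType} {d : nat} {disp : measure_display}
    {Omega : measurableType disp} (P : probability Omega R)
    (Y : Omega -> 'cV[R]_d) k l :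
  random_vector Y -> (forall i, ('E_P[fun w => (Y w i 0 ^+ 2)%R] < +oo)%E) ->
  cov_mx P Y k l = fine ('E_P[fun w => (Y w k 0 * Y w l 0)%R])%E -
    mean_vector P Y k 0 * mean_vector P Y l 0.
Proof.
move=> rY Y2.
have Pfin : P setT \is a fin_num := fin_num_measure P _ measurableT.
have L2Y i : (fun w => Y w i 0) \in Lfun P 2%:E by exact: Lfun2P.
have L1Y i := Lfun_subset12 Pfin (L2Y i).
have L1YY := Lfun2_mul_Lfun1 (L2Y k) (L2Y l).
rewrite !mxE covarianceE//.
by rewrite fineB ?fineM ?fin_numM ?expectation_fin_num.
Qed.

Lemma spectral_gap {R : realType} {d : nat} (S : 'M[R]_d) (lambda : 'I_d -> R)
    (e : 'I_d -> 'cV[R]_d) j :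
  spectral_decomposition S lambda e ->
  \rank (eigenspace S (lambda j)) = 1%N ->
  exists2 g : R, 0 < g & forall k, k != j -> g <= `|lambda k - lambda j|.
Proof.
move=> sS rk.
have gap k : k != j -> 0 < `|lambda k - lambda j|.
  by move=> kj; rewrite normr_gt0 subr_eq0 (simple_eigenvalue sS rk kj).
(* The default value 1 keeps the gap positive when [d = 1] and there is no other index. *)
exists (\big[Num.min/1]_(k < d | k != j) `|lambda k - lambda j|).
  exact: lt_bigmin ltr01 gap.
by move=> k kj; exact: bigmin_le_cond.
Qed.

Theorem proposition4 (R : realType) (I : interval R) (d : nat)
    (disp : measure_display) (Omega : measurableType disp)
    (P : probability Omega R)
    (M : set (L2 I)) (psi : L2 I -> 'cV[R]_d)
    (X : Omega -> L2 I) (Xs : nat -> Omega -> L2 I)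
    (psihat : forall n : nat, 'I_n -> Omega -> 'cV[R]_d)
    (lambda : 'I_d -> R) (e : 'I_d -> 'cV[R]_d)
    (lambdahat : nat -> Omega -> 'I_d -> R)
    (ehat : nat -> Omega -> 'I_d -> 'cV[R]_d)
    (v := max_error psi Xs psihat)
    (mu := mean_vector P (fun w => psi (X w)))
    (Sigma := cov_mx P (fun w => psi (X w)))
    (rate := fun (n : nat) (w : Omega) => v n w + 1 / Num.sqrt n%:R) :
  bounded_set [set` I] ->
  [set` I]° !=set0 ->
  representation_map M psi ->
  random_function X ->
  (forall w, M (X w)) ->
  (forall i, random_function (Xs i)) ->
  (forall i w, M (Xs i w)) ->
  independent_functions P Xs ->
  (forall i, same_distribution P (Xs i) X) ->
  (forall n (i : 'I_n), random_vector (psihat n i)) ->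
  (* (B1) *)
  ('E_P[v n])%E @[n --> \oo] --> 0%E ->
  (* (B2) *)
  (forall k : 'I_d, ('E_P[fun w => (psi (X w) k 0 ^+ 4)%R] < +oo)%E) ->
  posdef_mx Sigma ->
  spectral_decomposition Sigma lambda e ->
  (forall n w, (1 < n)%N ->
     spectral_decomposition (sample_cov (fun i : 'I_n => psihat n i w))
       (lambdahat n w) (ehat n w)) ->
  bigOp P
    (fun n w => enorm (sample_mean (fun i : 'I_n => psihat n i w) - mu)) rate
  /\
  (forall j : 'I_d, \rank (eigenspace Sigma (lambda j)) = 1%N ->
     (* the unit eigenvector is determined up to sign only *)
     ((forall n w, (1 < n)%N -> 0 <= dotcv (ehat n w j) (e j)) ->
        bigOp P (fun n w => enorm (ehat n w j - e j)) rate)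
     /\
     bigOp P (fun n w => `|lambdahat n w j - lambda j|) rate).
Proof.
move=> _ _ psiM rX MX rXs MXs indX law rpsihat EV E4 _ specS spechat.
pose F k (f : L2 I) : R := psi f k 0.
have cF k : real_continuous_on M (F k) := coord_continuous k psiM.
have cFF k l : real_continuous_on M (F k \* F l).
  by apply: real_continuous_onM.
have mF k : measurable_fun setT (F k \o X).
  exact: measurable_continuous_of rX MX (cF k).
(* This makes the products of coordinates square integrable, as Chebyshev's inequality for second
   moments demands; taking one factor equal to 1 yields the second moments of the coordinates. *)
have sqrM_le_4D4 (a b : R) : (a * b) ^+ 2 <= a ^+ 4 + b ^+ 4.
  rewrite -subr_ge0.
  have -> : a ^+ 4 + b ^+ 4 - (a * b) ^+ 2 =
    2^-1 * ((a ^+ 2 - b ^+ 2) ^+ 2 + (a ^+ 2) ^+ 2 + (b ^+ 2) ^+ 2) by field.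
  by rewrite mulr_ge0 ?addr_ge0 ?sqr_ge0// invr_ge0.
have sqr_le_1D4 (a : R) : a ^+ 2 <= 1 + a ^+ 4.
  by have := sqrM_le_4D4 1 a; rewrite mul1r expr1n.
have E2 k : ('E_P[fun w => (F k (X w) ^+ 2)%R] < +oo)%E.
  apply: (@expectation_dominated _ _ _ P (cst 1)
    (fun w => F k (X w) ^+ 4)) => //.
  - exact: (measurable_funX 4 (mF k)).
  - exact: (measurable_funX 2 (mF k)).
  - by move=> w; rewrite (exprM _ 2 2) sqr_ge0.
  - by move=> w; rewrite sqr_ge0.
  - by rewrite expectation_cst ltry.
  - exact: E4.
have E22 k l : ('E_P[fun w => ((F k (X w) * F l (X w)) ^+ 2)%R] < +oo)%E.
  apply: (@expectation_dominated _ _ _ P (fun w => F k (X w) ^+ 4)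
    (fun w => F l (X w) ^+ 4)) => //.
  - exact: (measurable_funX 4 (mF k)).
  - exact: (measurable_funX 4 (mF l)).
  - exact: (measurable_funX 2 (measurable_funM (mF k) (mF l))).
  - by move=> w; rewrite (exprM _ 2 2) sqr_ge0.
  - by move=> w; rewrite (exprM _ 2 2) sqr_ge0.
  - by move=> w; rewrite sqr_ge0.
  - exact: E4.
  - exact: E4.
pose m k := fine ('E_P[F k \o X])%E.
pose s k l := fine ('E_P[((F k \* F l) \o X)%R])%E.
have SigmaE k l : Sigma k l = s k l - m k * m l.
  by rewrite /Sigma cov_mxE// !mxE.
have mV n : measurable_fun setT (v n).
  apply: measurable_bigmax => i; apply: measurable_enorm => k.
  under eq_fun do rewrite !mxE.
  apply: measurable_funB; first exact: rpsihat.
  exact: measurable_continuous_of (rXs i) (MXs i) (cF k).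
have vle n (i : 'I_n) w : enorm (psihat n i w - psi (Xs i w)) <= v n w.
  exact: (le_bigmax _ (fun i : 'I_n => enorm (psihat n i w - psi (Xs i w)))).
have v0 n w : 0 <= v n w by exact: bigmax_ge_id.
have rate0 n w : (1 < n)%N -> 0 < rate n w.
  by move=> n1; rewrite ltr_wpDl// divr_gt0// sqrtr_gt0 ltr0n ltnW.
pose Q1 k (K : R) n w : Prop := `|n%:R^-1 * (\sum_(i < n) F k (Xs i w)) - m k|
  <= K / Num.sqrt n%:R.
pose Q2 (p : 'I_d * 'I_d) (K : R) n w : Prop :=
  `|n%:R^-1 * (\sum_(i < n) (F p.1 (Xs i w) * F p.2 (Xs i w))) - s p.1 p.2|
  <= K / Num.sqrt n%:R.
(* Constant in [K]; the argument only gives it the shape of the other two families. *)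
pose Q3 (K : R) n w : Prop := v n w <= 1.
have up (G : nat -> Omega -> R) :
    upward (fun K n w => G n w <= K / Num.sqrt n%:R).
  by move=> K K' n w KK' /le_trans; apply; rewrite ler_wpM2r// invr_ge0.
have u1 k : upward (Q1 k) by exact: up.
have u2 p : upward (Q2 p) by exact: up.
have ngt0 : \forall n \near \oo, (0 < n)%N by exists 1%N.
have t1 k : tight P (Q1 k).
  move=> eps eps0.
  have [K _ HK] := continuous_sample_mean_tight rX MX rXs MXs indX law (cF k)
    (E2 k) eps0.
  by exists K; apply: filterS ngt0.
have t2 p : tight P (Q2 p).
  move=> eps eps0.
  have [K _ HK] := continuous_sample_mean_tight rX MX rXs MXs indX law
    (cFF p.1 p.2) (E22 p.1 p.2) eps0.
  by exists K; apply: filterS ngt0.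
have t3 : tight P Q3.
  by move=> eps eps0; exists 0; exact: markov_near.
have uall1 := upward_forall u1.
have uall2 := upward_forall u2.
have u3 : upward Q3 by move=> ?.
have tall := tight_and (upward_and uall1 uall2) u3
  (tight_and uall1 uall2 (tight_forall u1 t1) (tight_forall u2 t2)) t3.
(* A single bound for all first and second population moments. *)
pose T := \sum_k `|m k| + \sum_k \sum_l `|s k l|.
have T0 : 0 <= T by rewrite addr_ge0// !sumr_ge0// => k _; rewrite sumr_ge0.
have sum_ge (J : finType) (G : J -> R) j : (forall i, 0 <= G i) ->
    G j <= \sum_i G i.
  by move=> G0; rewrite (bigD1 j)//= lerDl sumr_ge0.
have mT k : `|m k| <= T.
  apply: (le_trans (sum_ge _ (fun k => `|m k|) k _)) => //.
  by rewrite lerDl !sumr_ge0// => i _; rewrite sumr_ge0.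
have sT k l : `|s k l| <= T.
  apply: (le_trans (sum_ge _ (fun l => `|s k l|) l _)) => //.
  apply: (le_trans (sum_ge _ (fun k => \sum_l `|s k l|) k _)).
    by move=> i; rewrite sumr_ge0.
  by rewrite lerDr sumr_ge0.
(* The tightness constant carries no sign, whereas the moment bounds require a nonnegative one;
   monotonicity of [Q1] and [Q2] allows [K] to be replaced by its absolute value. *)
pose c (K : R) : R := 2 * ((3 + 2 * T + 3 * `|K|) + (1 + `|K|) * (2 * T + 2 * (1 + `|K|)))
   + 2 * (T + T ^+ 2).
have covb K n w : (1 < n)%N ->
    ((forall k, Q1 k K n w) /\ (forall p, Q2 p K n w)) /\ Q3 K n w ->
    forall k l, `|(sample_cov (fun i : 'I_n => psihat n i w) - Sigma) k l| <=
      c K * rate n w.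
  move=> n1 [[/(uall1 _ _ _ _ (ler_norm K)) h1 /(uall2 _ _ _ _ (ler_norm K)) h2]
    h3] k l.
  rewrite mxE [(- Sigma) k l]mxE SigmaE.
  apply: (@sample_cov_bound _ _ _ (fun i : 'I_n => psi (Xs i w))) => //.
  by move=> k' l'; exact: (h2 (k', l')).
split.
  apply: (tight_bigOp tall) => // K; exists (d%:R * (1 + `|K|)) => n w n1.
  move=> [[/(uall1 _ _ _ _ (ler_norm K)) h1 _] _].
  rewrite ger0_norm ?enorm_ge0// -mulrA.
  apply: (@sample_mean_bound _ _ _ (fun i : 'I_n => psi (Xs i w)) _ m) => //.
  by move=> k; rewrite mxE.
move=> j rk; split.
  move=> dot0; have [g g0 gap] := spectral_gap specS rk.
  apply: (tight_bigOp tall) => // K.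
  exists (4 * d%:R ^+ 3 * c K / g) => n w n1 /(covb K n w n1) h.
  rewrite ger0_norm ?enorm_ge0// [leRHS]mulrAC -mulrA.
  by have := eigenvector_perturbation specS (spechat n w n1) h g0 gap (dot0 n w n1);
    rewrite !mulrA.
apply: (tight_bigOp tall) => // K.
exists (d%:R ^+ 2 * c K) => n w n1 /(covb K n w n1) h.
rewrite normr_id -mulrA.
exact: eigenvalue_perturbation specS (spechat n w n1) h.
Qed.
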